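(* Let $R\in\mathcal{S}_1\cap B(H)_+$, fix a depth $n\ge 1$, and let $(R^{(k)},D_k)_{k\ge 1}$ be a depth $n$ (trace) greedy extraction sequence starting from $R^{(0)}=R$. Then for every $k\ge 0$, $$\mathrm{tr}(R^{(k)})\le\left(1-\frac{1}{N_n}\right)^k\mathrm{tr}(R).$$ In particular $R^{(k)}\to 0$ in trace norm as $k\to\infty$, and $R=\sum_{k=1}^\infty D_k$ with convergence in $\mathcal{S}_1$. More precisely, for each $m\ge 1$, $$\Big\|R-\sum_{k=1}^m D_k\Big\|_1=\|R^{(m)}\|_1\le\left(1-\frac{1}{N_n}\right)^m\mathrm{tr}(R).$$
   Context: $H$ is a Hilbert space and $B(H)_+$ is the set of bounded positive operators on $H$; $\mathcal{S}_1$ is the trace class with trace norm $\|\cdot\|_1$. $\mathcal{T}$ is a rooted finitely branching tree with root $\emptyset$; $|w|$ denotes the depth of a node $w$ and $\mathrm{ch}(w)$ the finite set of children of $w$. $\{W_w\}_{w\in\mathcal{T}}$ is a family of closed subspaces of $H$ with orthogonal projections $P_w$ such that: for each $n\ge 0$, $H=\bigoplus_{|w|=n}W_w$ (orthogonal sum), so $I=\sum_{|w|=n}P_w$; and for each node $w$, $W_w=\bigoplus_{v\in\mathrm{ch}(w)}W_v$ (orthogonal sum), i.e. $P_w=\sum_{v\in\mathrm{ch}(w)}P_v$ with $P_vP_{v'}=0$ for distinct $v,v'\in\mathrm{ch}(w)$. For $A\in B(H)_+$, $C_w(A)=A^{1/2}P_wA^{1/2}$. $\mathcal{T}_n=\{w\in\mathcal{T}:|w|=n\}$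 and $N_n=\#\mathcal{T}_n$. A depth $n$ (trace) greedy extraction sequence starting from $R$ is defined by $R^{(0)}=R$ and, for each $k\ge 1$: choose $w_k\in\mathcal{T}_n$ with $\mathrm{tr}(C_{w_k}(R^{(k-1)}))=\max_{w\in\mathcal{T}_n}\mathrm{tr}(C_w(R^{(k-1)}))$, and set $D_k=C_{w_k}(R^{(k-1)})$ and $R^{(k)}=R^{(k-1)}-D_k$. *)

(* Defs.v *)
From HB Require Import structures.
From mathcomp Require Import all_boot all_order all_algebra.
From mathcomp Require Import finmap.
From mathcomp Require Import sesquilinear complex.
From mathcomp Require Import all_classical all_reals all_analysis.
Set Implicit Arguments.
Unset Strict Implicit.
Unset Printing Implicit Defensive.
Import Order.TTheory GRing.Theory Num.Theory.
Import numFieldNormedType.Exports.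
Local Open Scope classical_set_scope.
Local Open Scope ring_scope.

(* Rooted, finitely branching trees. The value [parent root] is irrelevant:   *)
(* [children] ignores it and [depth] stops at the first visit to [root].      *)
Record rooted_tree := RootedTree {
  node :> choiceType;
  root : node;
  parent : node -> node;
  children : node -> {fset node};
  childrenP : forall w v : node,
    (v \in children w) = (v != root) && (parent v == w);
  rootedP : forall w : node, exists n, iter n parent w == root }.

Arguments root {r}.
Arguments parent {r}.
Arguments children {r}.

Definition depth (T : rooted_tree) (w : T) : nat := ex_minn (rootedP w).

Fixpoint level (T : rooted_tree) (n : nat) : {fset T} :=
  if n is m.+1 then (\bigcup_(w <- level T m) children w)%fset
  else [fset root]%fset.

Lemma depth_root (T : rooted_tree) : depth (@root T) = 0%N.
Proof.
rewrite /depth; case: ex_minnP => m _ /(_ 0%N) /=.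
by rewrite eqxx leqn0 => /(_ isT)/eqP.
Qed.

Lemma depth_parent (T : rooted_tree) (v : T) :
  v != root -> depth v = (depth (parent v)).+1.
Proof.
move=> v0; rewrite /depth; case: ex_minnP => -[|m].
  by rewrite /= (negPf v0).
rewrite iterSr => vm mmin; case: ex_minnP => p pv pmin; congr S.
apply/eqP; rewrite eqn_leq (pmin _ vm) andbT -ltnS.
by apply: mmin; rewrite iterSr.
Qed.

Lemma in_level (T : rooted_tree) (n : nat) (w : T) :
  (w \in level T n) = (depth w == n).
Proof.
elim: n w => [|n IHn] w /=.
  rewrite in_fset1; have [->|w0] := eqVneq w root; first by rewrite depth_root.
  by rewrite depth_parent.
apply/bigfcupP/eqP => [[v]|dw].
  rewrite andbT IHn => /eqP dv; rewrite childrenP => /andP[w0 /eqP pw].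
  by rewrite depth_parent // pw dv.
have w0 : w != root by apply/eqP => w0; move: dw; rewrite w0 depth_root.
exists (parent w); last by rewrite childrenP w0 eqxx.
by rewrite andbT IHn; move: dw; rewrite depth_parent // => -[->].
Qed.

(* A complex Hilbert space is given by a complete normed space [H] and an     *)
(* inner product [form], linear on the left. That [`|x| ^+ 2 = form x x] is   *)
(* not needed by the definitions: it is a hypothesis of the theorem.          *)
Section HilbertOperators.
Variables (R : realType) (H : completeNormedModType R[i]).
Variable form : {dot H for @Num.conj R[i]}.
Implicit Types (A P S : H -> H) (W V : set H).

Definition bounded_operator A :=
  linear A /\ exists M : R[i], forall x, `|A x| <= M * `|x|.

(* In [R[i]], [0 <= z] says that [z] is real and nonnegative. *)
Definition positive_operator A :=
  bounded_operator A /\ forall x, 0 <= form (A x) x.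

Definition closed_subspace W :=
  [/\ W 0, (forall (a : R[i]) x y, W x -> W y -> W (a *: x + y)) & closed W].

Definition orthogonal_projection W P :=
  forall x, W (P x) /\ forall y, W y -> form (x - P x) y = 0.

Definition orthogonal_sum (I : choiceType) (F : {fset I}) (W : I -> set H) V :=
  (forall v v', v \in F -> v' \in F -> v != v' ->
     forall x y, W v x -> W v' y -> form x y = 0) /\
  V = [set \sum_(v <- F) f v | f in [set f : I -> H | forall v, v \in F -> W v (f v)]].

(* [cst 0] is a dummy value, for operators that are not positive. *)
Definition sqrt_operator A : H -> H :=
  xget (cst 0) [set S | positive_operator S /\ S \o S = A].

(* [cst 0] is a dummy value, for maps that are not bounded operators. *)
Definition adjoint A : H -> H :=
  xget (cst 0) [set B | bounded_operator B /\ forall x y, form (A x) y = form x (B y)].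

Definition abs_operator A := sqrt_operator (adjoint A \o A).

Definition orthonormal_set (E : set H) :=
  (forall e, E e -> form e e = 1) /\
  (forall e e', E e -> E e' -> e != e' -> form e e' = 0).

Definition orthonormal_basis (E : set H) :=
  orthonormal_set E /\ forall x, (forall e, E e -> form x e = 0) -> x = 0.

Lemma orthonormal_basis_exists : exists E, orthonormal_basis E.
Proof.
have [|E [[E1 E0] maxE]] := @Zorn_bigcup H orthonormal_set.
  move=> F FO totF; split=> [e [X FX Xe]|e e' [X FX Xe] [Y FY Ye']].
    exact: (FO _ FX).1.
  have [XY|YX] := totF _ _ FX FY.
    by apply: (FO _ FY).2 => //; exact: XY.
  by apply: (FO _ FX).2 => //; exact: YX.
exists E; split=> // x xE; apply: contrapT => /eqP x0.
pose e0 := (sqrtC (form x x))^-1 *: x.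
have sx0 : 0 < sqrtC (form x x) by rewrite sqrt_dnorm_gt0.
have e0E e : E e -> form e0 e = 0.
  by move=> Ee; rewrite linearZl_LR /= (xE e) // mulr0.
have e0e0 : form e0 e0 = 1.
  rewrite dnormZ ger0_norm ?invr_ge0 ?ltW // exprVn sqrtCK mulVf //.
  by rewrite dnorm_eq0.
have Ee0 e : E e -> form e e0 = 0.
  by move=> Ee; rewrite (hermC form e e0) /= (e0E e) // rmorph0 mulr0.
apply: (maxE (E `|` [set e0])); first split.
- by move=> e; left.
- move=> /(_ e0 (or_intror erefl)) /e0E; rewrite e0e0 => /eqP.
  by rewrite oner_eq0.
- split=> [e [/E1|->]//|e e' [Ee|->] [Ee'|->]].
  + exact: E0.
  + by move=> _; exact: Ee0.
  + by move=> _; exact: e0E.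
  + by rewrite eqxx.
Qed.

Definition some_orthonormal_basis : set H := sval (cid orthonormal_basis_exists).

(* The trace of a positive operator, possibly [+oo], which does not depend on *)
(* the basis. It is not meant for operators that are not positive.            *)
Definition trace A : \bar R :=
  \esum_(e in some_orthonormal_basis) (complex.Re (form (A e) e))%:E.

Definition trace_norm A : \bar R := trace (abs_operator A).

Definition trace_class A := bounded_operator A /\ (trace_norm A < +oo)%E.

Definition cvg_trace_class (u : nat -> H -> H) A :=
  [/\ forall k, trace_class (u k), trace_class A
    & trace_norm (u k - A) @[k --> \oo] --> 0%E].

Definition compression P A := sqrt_operator A \o P \o sqrt_operator A.

Definition subspace_tree (T : rooted_tree) (W : T -> set H) :=
  [/\ forall w, closed_subspace (W w),
      forall n, orthogonal_sum (level T n) W setT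
    & forall w, orthogonal_sum (children w) W (W w)].

(* [D 0] is unused: the extracted terms are [D 1, D 2, ...]. *)
Definition greedy_extraction (T : rooted_tree) (P : T -> H -> H) (n : nat)
    (R0 : H -> H) (Rs D : nat -> H -> H) :=
  Rs 0%N = R0 /\
  forall k, exists w,
    [/\ w \in level T n,
        forall v, v \in level T n ->
          (trace (compression (P v) (Rs k)) <= trace (compression (P w) (Rs k)))%E,
        D k.+1 = compression (P w) (Rs k)
      & Rs k.+1 = Rs k - D k.+1].

End HilbertOperators.

(* Main.v *)
Require Import Defs.
From mathcomp Require Import all_boot all_order all_algebra.
From mathcomp Require Import finmap.
From mathcomp Require Import sesquilinear complex.
From mathcomp Require Import all_classical all_reals all_analysis.
From mathcomp Require Import ring lra.
Import Order.TTheory GRing.Theory Num.Theory.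
Import numFieldNormedType.Exports.
Local Open Scope classical_set_scope.
Local Open Scope ring_scope.

(** Write [C_w(A) = A^{1/2} P_w A^{1/2}].  The projections of one level add up
    to the identity, so the compressions [C_w(A)] of one level add up to
    [A^{1/2} A^{1/2} = A], and their traces add up to [tr A].  The largest of
    these [N] traces is at least [tr A / N]: removing it leaves at most
    [(1 - 1/N) tr A] ([greedy_step]).  What remains, [A - C_w(A) =
    A^{1/2} (I - P_w) A^{1/2}], is again positive, so the step can be iterated
    and gives the geometric decay ([greedy_trace_le]).  For a positive operator
    the trace norm is the trace, and [R - (D_1 + ... + D_m) = R^(m)]
    telescopes, so the decay of the trace is the convergence in trace class.

    All traces are computed in one fixed orthonormal basis, where additivity
    is termwise.

    The substance lies in square roots.  The operator [sqrt_operator A] is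
    a chosen positive square root: one needs that a root exists, to know that
    [A^{1/2} A^{1/2} = A], and that it is unique, to know that
    [|A| = (A^* A)^{1/2}] is [A] when [A] is positive.

    - Existence ([positive_sqrt_exists]).  After scaling, [A = I - B] with [B]
      self-adjoint and [|B x| <= |x|].  The root is [I - Y], where [Y] solves
      [2 Y = B + Y^2] and is the limit of [Y_{n+1} = (B + Y_n^2) / 2] from
      [Y_0 = 0].  Replacing [B] by 1 gives scalars [y_n], with
      [|Y_{n+1} x - Y_n x| <= (y_{n+1} - y_n) |x|] because
      [Y_{n+1} - Y_n = (Y_n - Y_{n-1}) (Y_n + Y_{n-1}) / 2]; and
      [1 - y_n <= 2 / (n + 1)].  So the iterates converge in operator norm, and
      every property of [Y] follows by estimates with the error [1 - y_n].
    - Uniqueness ([positive_sqrt_unique]).  The root just built commutes with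
      whatever commutes with [A], in particular with any other root [S'].  If
      [S] and [S'] commute and have the same square, [y = S x - S' x] satisfies
      [(S + S') y = 0], hence [<S y, y> = <S' y, y> = 0] by positivity, hence
      [S y = S' y = 0] and [|y|^2 = <x, S y - S' y> = 0].

    Estimates are carried out over the reals, with the real part of the inner
    product and the real-valued norm. *)

Set Implicit Arguments.
Unset Strict Implicit.
Unset Printing Implicit Defensive.

(** * The real inner product underlying a complex Hilbert space *)

Section RealInnerProduct.
Variables (K : realType) (H : completeNormedModType K[i]).
Variable form : {dot H for @Num.conj K[i]}.
Hypothesis norm_form : forall x : H, `|x| ^+ 2 = form x x.
Implicit Types (x y z : H) (a : K).

Definition rip x y : K := complex.Re (form x y).
Definition nrm x : K := complex.Re `|x|.

Lemma normE x : `|x| = (nrm x)%:C%C.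
Proof. by rewrite /nrm RRe_real // ger0_real. Qed.

Lemma nrm_ge0 x : 0 <= nrm x.
Proof. by have := normr_ge0 x; rewrite normE ler0c. Qed.

Lemma nrm0 : nrm 0 = 0.
Proof. by rewrite /nrm normr0. Qed.

Lemma nrm_eq0 x : nrm x = 0 -> x = 0.
Proof. by move=> x0; apply/eqP; rewrite -normr_eq0 normE x0. Qed.

Lemma nrmD x y : nrm (x + y) <= nrm x + nrm y.
Proof. by have := ler_normD x y; rewrite !normE -rmorphD lecR. Qed.

Lemma nrmN x : nrm (- x) = nrm x.
Proof. by rewrite /nrm normrN. Qed.

Lemma nrmC x y : nrm (x - y) = nrm (y - x).
Proof. by rewrite -nrmN opprB. Qed.

Lemma nrmZ (c : K[i]) x : nrm (c *: x) = complex.Re `|c| * nrm x.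
Proof.
rewrite {1}/nrm normrZ normE -{1}(RRe_real (ger0_real (normr_ge0 c))).
by rewrite -rmorphM.
Qed.

Lemma nrmZr a x : nrm (a%:C%C *: x) = `|a| * nrm x.
Proof. by rewrite nrmZ normc_def /= expr0n addr0 sqrtr_sqr. Qed.

Lemma nrm_sqr x : nrm x ^+ 2 = rip x x.
Proof. by rewrite /rip -norm_form normE -rmorphXn. Qed.

Lemma ReD (u v : K[i]) : complex.Re (u + v) = complex.Re u + complex.Re v.
Proof. by case: u v => [? ?] [? ?]. Qed.

Lemma ReN (u : K[i]) : complex.Re (- u) = - complex.Re u.
Proof. by case: u. Qed.

Lemma ripDl x y z : rip (x + y) z = rip x z + rip y z.
Proof. by rewrite /rip linearDl ReD. Qed.

Lemma ripDr x y z : rip x (y + z) = rip x y + rip x z.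
Proof. by rewrite /rip linearDr ReD. Qed.

Lemma ripZl a x y : rip (a%:C%C *: x) y = a * rip x y.
Proof.
by rewrite /rip linearZl_LR /=; case: (form x y) => b c /=; rewrite mul0r subr0.
Qed.

Lemma formC x y : form x y = ((form y x)^*)%C.
Proof. by rewrite hermC expr0 mul1r. Qed.

Lemma ripC x y : rip x y = rip y x.
Proof. by rewrite /rip formC; case: (form y x). Qed.

Lemma ripZr a x y : rip x (a%:C%C *: y) = a * rip x y.
Proof. by rewrite ripC ripZl ripC. Qed.

Lemma ripNl x y : rip (- x) y = - rip x y.
Proof. by rewrite /rip linearNl ReN. Qed.

Lemma ripNr x y : rip x (- y) = - rip x y.
Proof. by rewrite ripC ripNl ripC. Qed.

Lemma nrm_sqrB x y : nrm (x - y) ^+ 2 = nrm x ^+ 2 - 2 * rip x y + nrm y ^+ 2.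
Proof.
by rewrite !nrm_sqr !(ripDl, ripDr, ripNl, ripNr) (ripC y x); ring.
Qed.

Lemma rip_le_nrm x y : rip x y <= nrm x * nrm y.
Proof.
have [x0|x0] := eqVneq (nrm x) 0.
  by rewrite (nrm_eq0 x0) nrm0 mul0r /rip linear0l.
have [y0|y0] := eqVneq (nrm y) 0.
  by rewrite (nrm_eq0 y0) nrm0 mulr0 /rip linear0r.
have p0 : 0 < nrm x * nrm y by rewrite mulr_gt0 // lt_def ?x0 ?y0 nrm_ge0.
(* the norms serve as weights, so that no division is needed *)
have := sqr_ge0 (nrm ((nrm y)%:C%C *: x - (nrm x)%:C%C *: y)).
rewrite nrm_sqrB !nrmZr !ger0_norm ?nrm_ge0 // ripZl ripZr.
move=> h; rewrite -(ler_pM2l p0); nra.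
Qed.

(** Lets every statement on [form] be proved on its real part. *)
Lemma Im_form x y : complex.Im (form x y) = - rip ('i%C *: x) y.
Proof.
by rewrite /rip linearZl_LR /= mulrC ReiNIm opprK.
Qed.

(** Multiplication by [i] is skew for the real inner product. *)
Lemma rip_il x y : rip ('i%C *: x) y = - rip x ('i%C *: y).
Proof.
rewrite (ripC x) -[rip (_ *: x) _]opprK -[rip (_ *: y) _]opprK -!Im_form formC.
by case: (form y x) => /= ? ?; rewrite !opprK.
Qed.

Lemma form_ext x y : (forall z, rip z x = rip z y) -> x = y.
Proof.
move=> h; apply/eqP; rewrite -subr_eq0; apply/eqP/nrm_eq0/eqP.
by rewrite -sqrf_eq0 nrm_sqr ripDr ripNr h subrr.
Qed.

Lemma form_rip x y z w :
  (forall u, rip (u *: x) y = rip (u *: z) w) -> form x y = form z w.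
Proof.
move=> h; apply/eqP; rewrite eq_complex; apply/andP; split; apply/eqP.
  by have := h 1; rewrite !scale1r.
by rewrite !Im_form h.
Qed.

(** The bound [d n] on the later terms passes to the limit; stating it there
    makes the limit usable without any filter. *)
Lemma cvg_with_rate (u : nat -> H) (d : nat -> K) (c : K) :
  (forall n m, nrm (u (n + m)%N - u n) <= d n) ->
  (forall n, d n <= c / n.+1%:R) ->
  exists z, forall n, nrm (u n - z) <= d n.
Proof.
move=> ud dc.
have dlt (e : K) : 0 < e -> exists n, d n < e.
  move=> e0; pose N := Num.Def.archi_bound (`|c| / e).
  have := archi_boundP (divr_ge0 (normr_ge0 c) (ltW e0)).
  rewrite -/N ltr_pdivrMr // => cN; exists N; apply: le_lt_trans (dc N) _.
  rewrite ltr_pdivrMr ?ltr0n //; apply: le_lt_trans (ler_norm c) _.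
  by apply: lt_le_trans cN _; rewrite mulrC ler_pM2l // ler_nat.
have : cvg (u n @[n --> \oo]).
  apply: cauchy_cvg; apply: cauchy_exP => e e0.
  have e0' : 0 < complex.Re e by move: e0; rewrite ltcE => /andP[].
  have [N dN] := dlt _ e0'.
  exists (u N); exists N => // m /= Nm; rewrite -ball_normE /ball_ /=.
  rewrite -(RRe_real (gtr0_real e0)) normE ltcR nrmC.
  by rewrite -(subnKC Nm); apply: le_lt_trans (ud _ _) dN.
case/cvg_ex => z uz; exists z => n; apply/ler_addgt0Pr => e e0.
have /= : \forall m \near \oo, ball z e%:C%C (u m).
  by apply: uz; apply: nbhsx_ballx; rewrite ltcR.
case=> N _ /(_ (n + N)%N (leq_addl _ _)).
rewrite -ball_normE /ball_ /= normE ltcR => zN.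
have -> : u n - z = - (u (n + N)%N - u n) - (z - u (n + N)%N).
  by rewrite opprB opprB addrA subrK.
apply: le_trans (nrmD _ _) _; rewrite !nrmN.
by apply: lerD (ud _ _) (ltW zN).
Qed.

End RealInnerProduct.

(** * Bounded and positive operators *)

Section LinearMaps.
Variables (K : realType) (H : completeNormedModType K[i]) (A : H -> H).
Hypothesis linA : linear A.

Lemma lin0 : A 0 = 0.
Proof. by have := linA (-1) 0 0; rewrite scaler0 addr0 scaleN1r addNr. Qed.

Lemma linD x y : A (x + y) = A x + A y.
Proof. by have := linA 1 x y; rewrite !scale1r. Qed.

Lemma linZ a x : A (a *: x) = a *: A x.
Proof. by have := linA a x 0; rewrite lin0 !addr0. Qed.

Lemma linN x : A (- x) = - A x.
Proof. by rewrite -scaleN1r linZ scaleN1r. Qed.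

Lemma linB x y : A (x - y) = A x - A y.
Proof. by rewrite linD linN. Qed.

End LinearMaps.

Section PositiveOperators.
Variables (K : realType) (H : completeNormedModType K[i]).
Variable form : {dot H for @Num.conj K[i]}.
Hypothesis norm_form : forall x : H, `|x| ^+ 2 = form x x.
Local Notation rip := (rip form).
Implicit Types (x y z : H) (A B S : H -> H).

Lemma bounded_operatorP A : bounded_operator A <->
  linear A /\ exists2 M : K, 0 < M & forall x, nrm (A x) <= M * nrm x.
Proof.
split=> -[linA [M]] => [AM|_ AM]; split=> //; last first.
  by exists M%:C%C => x; rewrite !normE -rmorphM lecR.
exists (`|complex.Re M| + 1) => [|x]; first by rewrite ltr_wpDl.
have := AM x; rewrite !normE lecE => /andP[_] /=.
case: {AM}M => a b /=; rewrite mulr0 subr0 => /le_trans; apply.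
rewrite ler_wpM2r ?nrm_ge0 //; apply: le_trans (ler_norm _) _.
by rewrite lerDl.
Qed.

Lemma rip_ii x y : rip ('i%C *: x) ('i%C *: y) = rip x y.
Proof. by rewrite rip_il scalerA -expr2 sqr_i scaleN1r ripNr opprK. Qed.

(** The direct implication is polarization: the real quadratic form
    [z |-> <i A z, z>] vanishes because [<A z, z>] is real, and its value at
    [i x + y] is the defect of symmetry of [A]. *)
Lemma positive_operatorP A : positive_operator form A <->
  [/\ bounded_operator A, forall x y, rip (A x) y = rip x (A y)
    & forall x, 0 <= rip (A x) x].
Proof.
split=> [[bA pA]|[bA sA pA]]; last first.
  split=> // x; rewrite lecE pA andbT Im_form /= oppr_eq0; apply/eqP.
  have := sA ('i%C *: x) x; rewrite (linZ bA.1) [in RHS]rip_il.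
  by rewrite [rip x _]ripC; lra.
split=> // [x y|x]; last by have := pA x; rewrite lecE => /andP[].
have skew z : rip ('i%C *: A z) z = 0.
  have := pA z; rewrite lecE => /andP[/eqP + _].
  by rewrite Im_form /=; lra.
have := skew ('i%C *: x + y).
rewrite (linD bA.1) (linZ bA.1) scalerDr scalerA -expr2 sqr_i scaleN1r.
have := skew x; rewrite rip_il => skx.
by rewrite !(ripDl, ripDr) !ripNl skew rip_ii (ripC form x); lra.
Qed.

Lemma positive_form A x y :
  positive_operator form A -> form (A x) y = form x (A y).
Proof.
move=> /positive_operatorP[[linA _] sA _]; apply: form_rip => u.
by rewrite -(linZ linA) sA.
Qed.

End PositiveOperators.

(** * Square root of [I - B] for a self-adjoint contraction [B] *)

Section SquareRootIteration.
Variables (K : realType) (H : completeNormedModType K[i]).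
Variable form : {dot H for @Num.conj K[i]}.
Hypothesis norm_form : forall x : H, `|x| ^+ 2 = form x x.
Local Notation rip := (rip form).
Variable B : H -> H.
Hypothesis linB0 : linear B.
Hypothesis contrB : forall x, nrm (B x) <= nrm x.
Hypothesis symB : forall x y, rip (B x) y = rip x (B y).
Implicit Types (x y z : H).

(** If [Y] is a fixed point of this iteration then [(I - Y)^2 = I - B]. *)
Fixpoint sqrt_iter n x : H :=
  if n is m.+1 then (2^-1)%:C%C *: (B x + sqrt_iter m (sqrt_iter m x)) else 0.

Lemma sqrt_iterS n x :
  sqrt_iter n.+1 x = (2^-1)%:C%C *: (B x + sqrt_iter n (sqrt_iter n x)).
Proof. by []. Qed.

(** The iteration for [B = 1]; its limit is 1. *)
Fixpoint sqrt_majorant n : K :=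
  if n is m.+1 then (1 + sqrt_majorant m ^+ 2) / 2 else 0.

Lemma sqrt_majorant_bounds n : 0 <= sqrt_majorant n <= 1.
Proof.
elim: n => [|n /andP[h0 h1]] /=; first by rewrite lexx ler01.
by apply/andP; split; nra.
Qed.

(** The gap [d_n = 1 - y_n] follows [d_{n+1} = d_n - d_n^2 / 2], whose solution
    behaves like [2 / n]; the induction needs the sharper [2 / (n + 2)], which
    is exact at [n = 0]. *)
Lemma sqrt_majorant_rate n : 1 - sqrt_majorant n <= 2 / n.+1%:R.
Proof.
apply: (@le_trans _ _ (2 / n.+2%:R)); last first.
  by rewrite ler_pM2l // lef_pV2 ?posrE ?ltr0n // ler_nat.
elim: n => [|n IH] /=; first by rewrite divff // subr0.
have /andP[y0 y1] := sqrt_majorant_bounds n.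
set t : K := 2 / n.+2%:R in IH.
have n0 : (0 : K) <= n%:R by [].
have n2 : n.+2%:R = n%:R + 2 :> K by rewrite -addn2 natrD.
have n3 : n.+3%:R = n%:R + 3 :> K by rewrite -addn3 natrD.
have t1 : t <= 1 by rewrite ler_pdivrMr ?ltr0n // n2; lra.
(* [t - t^2 / 2] increases with [t] on the unit interval *)
apply: (@le_trans _ _ (t - t ^+ 2 / 2)); first by nra.
rewrite /t n2 n3 -subr_ge0.
have -> : 2 / (n%:R + 3) - (2 / (n%:R + 2) - (2 / (n%:R + 2)) ^+ 2 / 2)
    = 2 / ((n%:R + 3) * (n%:R + 2) ^+ 2) :> K.
  by field; apply/andP; split; lra.
by rewrite divr_ge0 // mulr_ge0 ?sqr_ge0 //; lra.
Qed.

Lemma sqrt_iter_linear n : linear (sqrt_iter n).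
Proof.
elim: n => [|n IH] a x y /=; first by rewrite scaler0 addr0.
by rewrite linB0 IH IH addrACA -scalerDr [LHS]scalerDr !scalerA mulrC.
Qed.

Lemma sqrt_iter_comm (C : H -> H) n x : linear C ->
  (forall z, C (B z) = B (C z)) -> C (sqrt_iter n x) = sqrt_iter n (C x).
Proof.
move=> linC CB; elim: n x => [|n IH] x /=; first exact: lin0.
by rewrite (linZ linC) (linD linC) CB !IH.
Qed.

Lemma sqrt_iterC m n x :
  sqrt_iter m (sqrt_iter n x) = sqrt_iter n (sqrt_iter m x).
Proof.
apply: sqrt_iter_comm => [|z]; first exact: sqrt_iter_linear.
by rewrite -sqrt_iter_comm.
Qed.

Lemma sqrt_iter_sym n x y : rip (sqrt_iter n x) y = rip x (sqrt_iter n y).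
Proof.
elim: n x y => [|n IH] x y /=; first by rewrite /rip linear0l linear0r.
by rewrite ripZl ripZr ripDl ripDr symB !IH.
Qed.

Lemma sqrt_iter_le n x : nrm (sqrt_iter n x) <= sqrt_majorant n * nrm x.
Proof.
elim: n x => [|n IH] x /=; first by rewrite nrm0 mul0r.
rewrite nrmZr ger0_norm ?invr_ge0 //.
have /andP[y0 _] := sqrt_majorant_bounds n.
have := nrmD (B x) (sqrt_iter n (sqrt_iter n x)).
have := contrB x; have := IH (sqrt_iter n x); have := IH x.
have := nrm_ge0 x; have := nrm_ge0 (sqrt_iter n x); nra.
Qed.

(** Since the iterates commute, [Y_{n+2} - Y_{n+1} =
    (Y_{n+1} - Y_n) (Y_{n+1} + Y_n) / 2], and likewise for the scalars. *)
Lemma sqrt_iter_step n x : nrm (sqrt_iter n.+1 x - sqrt_iter n x)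
  <= (sqrt_majorant n.+1 - sqrt_majorant n) * nrm x.
Proof.
elim: n x => [|n IH] x.
  rewrite /= !subr0 !addr0 expr0n addr0 mul1r nrmZr.
  by rewrite ger0_norm ?invr_ge0 // ler_pM2l ?invr_gt0.
set y1 := sqrt_majorant n.+1 in IH *; set y0 := sqrt_majorant n in IH *.
have e : sqrt_iter n.+2 x - sqrt_iter n.+1 x = (2^-1)%:C%C *:
   (sqrt_iter n.+1 (sqrt_iter n.+1 x + sqrt_iter n x)
    - sqrt_iter n (sqrt_iter n.+1 x + sqrt_iter n x)).
  rewrite (sqrt_iterS n.+1) [X in _ - X = _](sqrt_iterS n) -scalerBr.
  congr (_ *: _); rewrite (linD (sqrt_iter_linear n.+1)).
  rewrite (linD (sqrt_iter_linear n)) (sqrt_iterC n.+1 n).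
  by rewrite opprD addrACA subrr add0r opprD addrA addrK.
rewrite e nrmZr ger0_norm ?invr_ge0 //.
have -> : sqrt_majorant n.+2 - y1 = 2^-1 * ((y1 - y0) * (y1 + y0)).
  by rewrite /y1 /y0 /=; field.
rewrite -mulrA ler_pM2l ?invr_gt0 //; apply: le_trans (IH _) _.
have y01 : 0 <= y1 - y0.
  have -> : y1 - y0 = (1 - y0) ^+ 2 / 2 by rewrite /y1 /y0 /=; field.
  by rewrite divr_ge0 ?sqr_ge0.
rewrite -mulrA ler_wpM2l // mulrDl; apply: le_trans (nrmD _ _) _.
by apply: lerD; exact: sqrt_iter_le.
Qed.

Lemma sqrt_iter_cauchy n m x : nrm (sqrt_iter (n + m)%N x - sqrt_iter n x)
  <= (1 - sqrt_majorant n) * nrm x.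
Proof.
have /andP[_ y1] := sqrt_majorant_bounds (n + m).
suff : nrm (sqrt_iter (n + m)%N x - sqrt_iter n x)
    <= (sqrt_majorant (n + m) - sqrt_majorant n) * nrm x.
  by have := nrm_ge0 x; nra.
elim: m {y1} => [|m IH]; first by rewrite addn0 !subrr nrm0 mul0r.
rewrite addnS -(subrK (sqrt_iter (n + m) x) (sqrt_iter _.+1 x)) -addrA.
by apply: le_trans (nrmD _ _) _; have := sqrt_iter_step (n + m) x; lra.
Qed.

(** How each property of the limit is obtained from the iterates. *)
Lemma le0_of_majorant_gap (a c : K) :
  (forall n, a <= c * (1 - sqrt_majorant n)) -> 0 <= c -> a <= 0.
Proof.
move=> h c0; rewrite leNgt; apply/negP => a0.
pose N := Num.Def.archi_bound (2 * c / a).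
have c2 : 0 <= 2 * c / a by rewrite divr_ge0 ?mulr_ge0 // ltW.
have := archi_boundP c2.
rewrite -/N ltr_pdivrMr // => cN.
have := h N; apply/negP; rewrite -ltNge.
apply: le_lt_trans (ler_wpM2l c0 (sqrt_majorant_rate N)) _.
rewrite mulrA [c * 2]mulrC ltr_pdivrMr ?ltr0n //; apply: lt_le_trans cN _.
by rewrite mulrC ler_pM2l // ler_nat.
Qed.

(** Uniqueness of square roots will rest on the last clause. *)
Lemma contraction_sqrt : exists Y : H -> H,
  [/\ linear Y, forall x, nrm (Y x) <= nrm x,
      forall x y, rip (Y x) y = rip x (Y y),
      forall x, Y x + Y x = B x + Y (Y x)
    & forall C : H -> H, bounded_operator C ->
        (forall x, C (B x) = B (C x)) -> forall x, C (Y x) = Y (C x)].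
Proof.
have rate x n : (1 - sqrt_majorant n) * nrm x <= 2 * nrm x / n.+1%:R.
  rewrite mulrAC; apply: ler_wpM2r; first exact: nrm_ge0.
  exact: sqrt_majorant_rate.
have /choice[Y Yx] x :=
  cvg_with_rate (fun n m => sqrt_iter_cauchy n m x) (rate x).
(* characterizes the limit, up to any constant factor in the rate *)
have limE x z c : 0 <= c ->
    (forall n, nrm (sqrt_iter n x - z) <= c * (1 - sqrt_majorant n)) -> Y x = z.
  move=> c0 h; apply/eqP; rewrite -subr_eq0; apply/eqP/nrm_eq0/eqP.
  rewrite eq_le nrm_ge0 andbT.
  apply: (@le0_of_majorant_gap _ (c + nrm x)) => [n|];
    last by rewrite addr_ge0 ?nrm_ge0.
  rewrite -(subrKA (sqrt_iter n x)); apply: le_trans (nrmD _ _) _.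
  by rewrite nrmC; have := Yx x n; have := h n; lra.
have linY : linear Y.
  move=> a x y.
  apply: (limE _ _ (complex.Re `|a| * nrm x + nrm y)) => [|n].
    rewrite addr_ge0 ?nrm_ge0 // mulr_ge0 ?nrm_ge0 //.
    by rewrite -ler0c RRe_real ?ger0_real.
  rewrite sqrt_iter_linear opprD addrACA -scalerBr.
  apply: le_trans (nrmD _ _) _; rewrite nrmZ.
  have a0 : 0 <= complex.Re `|a| by rewrite -ler0c RRe_real ?ger0_real.
  have := ler_wpM2l a0 (Yx x n); have := Yx y n; lra.
have Yle x : nrm (Y x) <= nrm x.
  rewrite -subr_le0; apply: (@le0_of_majorant_gap _ (nrm x)) => [n|];
    last exact: nrm_ge0.
  have := nrmD (sqrt_iter n x) (Y x - sqrt_iter n x).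
  rewrite addrC subrK nrmC; have := Yx x n; have := sqrt_iter_le n x.
  have := nrm_ge0 x; have /andP[_] := sqrt_majorant_bounds n; nra.
exists Y; split=> // [x y|x|C /bounded_operatorP[linC [M M0 CM]] CB x].
- have le x' y' : rip (Y x') y' - rip x' (Y y') <= 0.
    apply: (@le0_of_majorant_gap _ (2 * (nrm x' * nrm y'))) => [n|]; last first.
      by rewrite !mulr_ge0 ?nrm_ge0.
    have := rip_le_nrm norm_form (Y x' - sqrt_iter n x') y'.
    have := rip_le_nrm norm_form x' (sqrt_iter n y' - Y y').
    rewrite nrmC ripDl ripNl ripDr ripNr sqrt_iter_sym [nrm (Y x' - _)]nrmC nrmC.
    have := Yx x' n; have := Yx y' n.
    have := nrm_ge0 x'; have := nrm_ge0 y'; nra.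
  apply/eqP; rewrite -subr_eq0 eq_le le /=.
  by have := le y x; rewrite (ripC form x) (ripC form (Y x)); lra.
- suff e : Y x = (2^-1)%:C%C *: (B x + Y (Y x)).
    by rewrite {1 2}e -scalerDl -rmorphD -div1r -splitr scale1r.
  apply: (limE _ _ (3 * nrm x)) => [|n]; first by rewrite mulr_ge0 ?nrm_ge0.
  have d0 := nrm_ge0 x; have /andP[y0 y1] := sqrt_majorant_bounds n.
  (* the error at stage [n + 1] is half that of [Y_n (Y_n x)], and
     [1 - y_n <= 2 (1 - y_{n+1})] *)
  case: n y0 y1 => [|n] y0 y1.
    rewrite /= sub0r nrmN nrmZr ger0_norm ?invr_ge0 //.
    have := nrmD (B x) (Y (Y x)); have := contrB x.
    have := Yle (Y x); have := Yle x; lra.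
  rewrite [sqrt_iter _ _]/= -scalerBr opprD addrACA subrr add0r nrmZr.
  rewrite ger0_norm ?invr_ge0 //.
  rewrite -(subrKA (sqrt_iter n (Y x))) -(linB (sqrt_iter_linear n)).
  have := nrmD (sqrt_iter n (sqrt_iter n x - Y x))
    (sqrt_iter n (Y x) - Y (Y x)).
  have := sqrt_iter_le n (sqrt_iter n x - Y x).
  have := Yx x n; have := Yx (Y x) n; have := Yle x.
  have /andP[] := sqrt_majorant_bounds n; move: y0 y1 => /=.
  set u := nrm _; set v := nrm _; set w := nrm _; set s := nrm _; set t := nrm _.
  set r := sqrt_majorant n => _ _ r0 r1 tx ws uv sr wuv.
  have s0 : 0 <= s by exact: nrm_ge0.
  have ts : t <= (1 - r) * v by nra.
  have wv : w <= (1 - r) * v by nra.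
  have q0 : 0 <= (1 - r) * v by rewrite mulr_ge0 // subr_ge0.
  have qr : 0 <= (1 - r) * v * r by rewrite mulr_ge0.
  by lra.
- apply/esym; apply: (limE _ _ (M * nrm x)) => [|n].
    by apply: mulr_ge0; [exact: ltW | exact: nrm_ge0].
  rewrite -sqrt_iter_comm // -(linB linC) (le_trans (CM _)) // -mulrA.
  by rewrite ler_pM2l // mulrC; exact: Yx.
Qed.

End SquareRootIteration.

(** * Existence and uniqueness of positive square roots *)

Section SquareRoots.
Variables (K : realType) (H : completeNormedModType K[i]).
Variable form : {dot H for @Num.conj K[i]}.
Hypothesis norm_form : forall x : H, `|x| ^+ 2 = form x x.
Local Notation rip := (rip form).
Implicit Types (x y z : H) (A B S : H -> H).

Lemma bounded_operator_comp A B :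
  bounded_operator A -> bounded_operator B -> bounded_operator (A \o B).
Proof.
move=> /bounded_operatorP[linA [a a0 Aa]] /bounded_operatorP[linB [b b0 Bb]].
apply/bounded_operatorP; split.
  by move=> c x y /=; rewrite linB linA.
exists (a * b) => [|x /=]; first exact: mulr_gt0.
by apply: le_trans (Aa _) _; rewrite -mulrA ler_pM2l.
Qed.

Lemma bounded_operatorB A B :
  bounded_operator A -> bounded_operator B -> bounded_operator (A - B).
Proof.
move=> /bounded_operatorP[linA [a a0 Aa]] /bounded_operatorP[linB [b b0 Bb]].
apply/bounded_operatorP; split.
  move=> c x y; rewrite !fctE linA linB.
  by rewrite opprD addrACA -scalerBr.
exists (a + b) => [|x]; first exact: addr_gt0.
rewrite !fctE; apply: le_trans (nrmD _ _) _; rewrite nrmN mulrDl.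
exact: lerD.
Qed.

(** The inequality [A^2 <= M A], read off from [<A z, z> >= 0] at
    [z = M x - A x]. *)
Lemma positive_nrm_sqr A (M : K) x : positive_operator form A -> 0 < M ->
  (forall z, nrm (A z) <= M * nrm z) -> nrm (A x) ^+ 2 <= M * rip (A x) x.
Proof.
move=> /positive_operatorP[[linA _] sA pA] M0 AM.
have := pA (M%:C%C *: x - A x).
rewrite (linB linA) (linZ linA) !(ripDl, ripDr, ripNl, ripNr, ripZl, ripZr).
rewrite (sA (A x) x) -(nrm_sqr norm_form).
have := rip_le_nrm norm_form (A (A x)) (A x).
have := AM (A x); have := nrm_ge0 (A x).
set u := nrm (A (A x)); set v := nrm (A x) => v0 uv.
set s := rip (A (A x)) (A x) => suv h.
have sv : s <= M * v ^+ 2 by nra.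
by rewrite -(ler_pM2l M0); nra.
Qed.

Lemma positive_eq0 A x : positive_operator form A -> rip (A x) x = 0 -> A x = 0.
Proof.
move=> pA x0; have /bounded_operatorP[_ [M M0 AM]] := pA.1.
have := positive_nrm_sqr x pA M0 AM; rewrite x0 mulr0 => h.
by apply/nrm_eq0/eqP; rewrite -sqrf_eq0 eq_le h sqr_ge0.
Qed.

(** With [B = I - A / M] and [Y] the fixed point for [B], the root is
    [M^{1/2} (I - Y)]; that [B] is a contraction is [A^2 <= M A]. *)
Lemma positive_sqrt_exists A : positive_operator form A ->
  exists S, [/\ positive_operator form S, S \o S = A
    & forall C, bounded_operator C -> C \o A = A \o C -> C \o S = S \o C].
Proof.
move=> pA; have [bA sA _] := (positive_operatorP form A).1 pA.
have /bounded_operatorP[linA [M M0 AM]] := bA.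
pose B x := x - (M^-1)%:C%C *: A x.
have linB' : linear B.
  move=> a x y; rewrite /B linA scalerDr opprD addrACA; congr (_ + _).
  by rewrite scalerBr !scalerA mulrC.
have Ble x : nrm (B x) <= nrm x.
  rewrite -ler_sqr ?nnegrE ?nrm_ge0 // (nrm_sqrB norm_form).
  have Mi : 0 < M^-1 by rewrite invr_gt0.
  rewrite nrmZr (gtr0_norm Mi) ripZr (ripC form x).
  have := positive_nrm_sqr x pA M0 AM; have := (pA.2 x).
  rewrite lecE => /andP[_]; rewrite -/(rip (A x) x) /=.
  set r := rip _ _; set v := nrm (A x); move=> r0 vr.
  have -> : (M^-1 * v) ^+ 2 = M^-1 * (M^-1 * v ^+ 2) by ring.
  have : M^-1 * v ^+ 2 <= r.
    by rewrite -(ler_pM2l M0) mulrA mulfV ?gt_eqF ?mul1r.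
  move=> /(ler_wpM2l (ltW Mi)) qv; have := mulr_ge0 (ltW Mi) r0; lra.
have sB x y : rip (B x) y = rip x (B y).
  by rewrite !(ripDl, ripDr, ripNl, ripNr, ripZl, ripZr) sA.
have [Y [linY Yle sY YE CY]] := contraction_sqrt norm_form linB' Ble sB.
pose m := Num.sqrt M; have mm : m * m = M by rewrite -expr2 sqr_sqrtr ?ltW.
have m0 : 0 <= m by exact: sqrtr_ge0.
exists (fun x => m%:C%C *: (x - Y x)); split.
- apply/positive_operatorP; split.
  + apply/bounded_operatorP; split.
      move=> a x y; rewrite linY opprD addrACA -scalerBr scalerDr.
      by rewrite !scalerA mulrC.
    exists (m * 2) => [|x]; first by rewrite mulr_gt0 // sqrtr_gt0.
    rewrite nrmZr ger0_norm // -mulrA ler_wpM2l //.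
    by apply: le_trans (nrmD _ _) _; rewrite nrmN; have := Yle x; lra.
  + by move=> x y; rewrite !(ripDl, ripDr, ripNl, ripNr, ripZl, ripZr) sY.
  + move=> x; rewrite ripZl mulr_ge0 // ripDl ripNl -(nrm_sqr norm_form).
    have := rip_le_nrm norm_form (Y x) x.
    have := Yle x; have := nrm_ge0 x; nra.
- apply/funext => x /=; rewrite (linZ linY) (linB linY) -scalerBr scalerA.
  have Bx : B x = Y x + Y x - Y (Y x) by rewrite YE addrK.
  rewrite -rmorphM mm -addrA -opprD addrA -Bx.
  by rewrite /B subKr scalerA -rmorphM mulfV ?gt_eqF // scale1r.
- move=> C bC /(congr1 (fun f => f _)) /= CA; apply/funext => x /=.
  have linC := bC.1.
  rewrite (linZ linC) (linB linC) CY // => z.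
  by rewrite /B (linB linC) (linZ linC) CA.
Qed.

(** Applying [S + S'] to [y = S x - S' x] gives [S^2 x - S'^2 x = 0]; both
    [<S y, y>] and [<S' y, y>] are nonnegative, so both vanish. *)
Lemma positive_sqrt_eq_of_comm S S' :
  positive_operator form S -> positive_operator form S' ->
  S \o S = S' \o S' -> S \o S' = S' \o S -> S = S'.
Proof.
move=> pS pS' SS SC.
have [[linS _] sS S0] := (positive_operatorP form S).1 pS.
have [[linS' _] sS' S'0] := (positive_operatorP form S').1 pS'.
apply/funext => x; apply/eqP; rewrite -subr_eq0; apply/eqP.
set y := S x - S' x.
have y0 : S y + S' y = 0.
  rewrite /y (linB linS) (linB linS').
  have /= -> := congr1 (fun f => f x) SC.
  have /= -> := congr1 (fun f => f x) SS.
  by rewrite addrA subrK subrr.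
have r0 : rip (S y) y + rip (S' y) y = 0 by rewrite -ripDl y0 /rip linear0l.
have Sy : S y = 0 by apply: positive_eq0 pS _; have := S0 y; have := S'0 y; lra.
have S'y : S' y = 0 by move: y0; rewrite Sy add0r.
apply/nrm_eq0/eqP; rewrite -sqrf_eq0 (nrm_sqr norm_form) {1}/y.
by rewrite ripDl ripNl sS sS' Sy S'y subrr.
Qed.

Lemma positive_operator_sqr S : positive_operator form S ->
  positive_operator form (S \o S).
Proof.
move=> /positive_operatorP[bS sS _].
apply/positive_operatorP; split; first exact: bounded_operator_comp.
  by move=> x y /=; rewrite !sS.
by move=> x /=; rewrite sS -(nrm_sqr norm_form) sqr_ge0.
Qed.

(** Both roots are compared with the constructed one, which commutes with
    each. *)
Lemma positive_sqrt_unique S S' :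
  positive_operator form S -> positive_operator form S' ->
  S \o S = S' \o S' -> S = S'.
Proof.
move=> pS pS' SS.
have [Q [pQ QQ CQ]] := positive_sqrt_exists (positive_operator_sqr pS).
transitivity Q.
  by apply: positive_sqrt_eq_of_comm => //; exact: CQ pS.1 _.
apply/esym/positive_sqrt_eq_of_comm => //; first by rewrite QQ SS.
by apply: CQ pS'.1 _; rewrite SS.
Qed.

Lemma sqrt_operatorP A : positive_operator form A ->
  positive_operator form (sqrt_operator form A) /\
  sqrt_operator form A \o sqrt_operator form A = A.
Proof.
move=> /positive_sqrt_exists[S [pS SS _]].
by apply: (@xgetPex _ (cst 0) [set S | positive_operator form S /\ S \o S = A]);
  exists S.
Qed.

Lemma sqrt_operator_eq S : positive_operator form S ->
  sqrt_operator form (S \o S) = S.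
Proof.
move=> pS; have [pQ QQ] := sqrt_operatorP (positive_operator_sqr pS).
exact: positive_sqrt_unique.
Qed.

Lemma adjoint_eq A B : bounded_operator B ->
  (forall x y, form (A x) y = form x (B y)) -> adjoint form A = B.
Proof.
move=> bB AB.
have [_ AC] := xgetPex (cst 0 : H -> H) (ex_intro
  [set B | bounded_operator B /\ forall x y, form (A x) y = form x (B y)]
  B (conj bB AB)).
apply/funext => y; apply: (form_ext norm_form) => x.
by congr complex.Re; rewrite -AC AB.
Qed.

Lemma abs_operator_positive A : positive_operator form A ->
  abs_operator form A = A.
Proof.
move=> pA; rewrite /abs_operator (adjoint_eq pA.1) ?sqrt_operator_eq // => x y.
exact: positive_form.
Qed.

(** Needed because the partial sums approach [R] from below: their error is
    the opposite of a positive operator. *)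
Lemma abs_operator_opp A : positive_operator form A ->
  abs_operator form (- A) = A.
Proof.
move=> pA.
have AA : (- A) \o (- A) = A \o A.
  by apply/funext => x; rewrite -[LHS]/(- A (- A x)) (linN pA.1.1) opprK.
rewrite /abs_operator (@adjoint_eq _ (- A)) ?AA ?sqrt_operator_eq // => [|x y].
  rewrite -sub0r; apply: bounded_operatorB pA.1; split=> [c x y|].
    by rewrite scaler0 addr0.
  by exists 0 => x; rewrite normr0 mul0r.
have -> : form ((- A) x) y = - form (A x) y by exact: linearNl.
by rewrite (positive_form _ _ pA); exact/esym/linearNr.
Qed.

End SquareRoots.

(** * Orthogonal projections *)

Section OrthogonalProjections.
Variables (K : realType) (H : completeNormedModType K[i]).
Variable form : {dot H for @Num.conj K[i]}.
Hypothesis norm_form : forall x : H, `|x| ^+ 2 = form x x.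
Local Notation rip := (rip form).
Implicit Types (x y z : H) (W : set H) (P : H -> H).

Lemma orthogonal_projection_unique W P x z : closed_subspace W ->
  orthogonal_projection form W P ->
  W z -> (forall y, W y -> form (x - z) y = 0) -> P x = z.
Proof.
move=> [_ subW _] projP Wz xz; have [WPx xP] := projP x.
have Wd : W (P x - z) by rewrite addrC -scaleN1r; exact: subW.
apply/eqP; rewrite -subr_eq0 -(dnorm_eq0 form).
have -> : form (P x - z) (P x - z) = form ((x - z) - (x - P x)) (P x - z).
  by congr (form _ _); rewrite opprB [RHS]addrC addrA subrK.
by rewrite linearBl /= xz // xP // subrr.
Qed.

Lemma orthogonal_projection_linear W P : closed_subspace W ->
  orthogonal_projection form W P -> linear P.
Proof.
move=> cW projP a x y; apply: (orthogonal_projection_unique cW projP).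
  by case: cW => _ subW _; apply: subW; [case: (projP x) | case: (projP y)].
move=> z Wz; rewrite opprD addrACA -scalerBr linearDl /= linearZl_LR /=.
by rewrite (projP x).2 // (projP y).2 // mulr0 addr0.
Qed.

Lemma orthogonal_projection_form W P x :
  orthogonal_projection form W P -> form (P x) x = form (P x) (P x).
Proof.
move=> projP; have := (projP x).2 _ (projP x).1.
rewrite linearBl => /eqP; rewrite subr_eq0 => /eqP xP.
by rewrite formC xP -formC.
Qed.

Lemma orthogonal_projection_le W P x :
  orthogonal_projection form W P -> nrm (P x) <= nrm x.
Proof.
move=> projP.
have e : nrm (P x) ^+ 2 = rip (P x) x.
  rewrite (nrm_sqr norm_form); congr complex.Re.
  by rewrite (orthogonal_projection_form x projP).
have := rip_le_nrm norm_form (P x) x; rewrite -e.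
have := nrm_ge0 x; have := nrm_ge0 (P x); nra.
Qed.

Lemma orthogonal_projection_positive W P : closed_subspace W ->
  orthogonal_projection form W P -> positive_operator form P.
Proof.
move=> cW projP; split.
  apply/bounded_operatorP; split; first exact: orthogonal_projection_linear projP.
  by exists 1 => // x; rewrite mul1r; exact: orthogonal_projection_le projP.
by move=> x; rewrite (orthogonal_projection_form x projP) dnorm_ge0.
Qed.

Lemma orthogonal_projectionC_positive W P : closed_subspace W ->
  orthogonal_projection form W P ->
  positive_operator form (fun x => x - P x).
Proof.
move=> cW projP; have pP := orthogonal_projection_positive cW projP.
have bid : bounded_operator (id : H -> H).
  by split=> //; exists 1 => x; rewrite mul1r.
split=> [|x]; first exact: bounded_operatorB bid pP.1.
have -> : form (x - P x) x = form (x - P x) (x - P x).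
  have xP := (projP x).2 _ (projP x).1.
  by rewrite [RHS]linearBr /= xP subr0.
exact: dnorm_ge0.
Qed.

(** In the decomposition [x = \sum_v f v] given by the orthogonal sum, the
    terms other than [f v] are orthogonal to [W v], so [f v] is [P v x]. *)
Lemma orthogonal_sum_projections (I : choiceType) (F : {fset I})
    (W : I -> set H) (P : I -> H -> H) x :
  (forall v, closed_subspace (W v)) ->
  (forall v, orthogonal_projection form (W v) (P v)) ->
  orthogonal_sum form F W setT -> \sum_(v <- F) P v x = x.
Proof.
move=> cW projP [ortW WT].
have : setT x by []. rewrite WT => -[f /= Wf fx].
rewrite -[RHS]fx; apply: eq_big_seq => v Fv.
apply: (orthogonal_projection_unique (cW v) (projP v)); first exact: Wf.
move=> y Wy; rewrite -fx (bigD1_seq v) ?fset_uniq //= addrAC subrr add0r.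
rewrite big_seq_cond; elim/big_ind: _ => [|a b a0 b0|u /andP[Fu uv]].
- exact: linear0l.
- by rewrite linearDl /= a0 b0 addr0.
- by apply: (ortW u v) => //; exact: Wf.
Qed.

End OrthogonalProjections.

(** * Traces and compressions of positive operators *)

Section Traces.
Variables (K : realType) (H : completeNormedModType K[i]).
Variable form : {dot H for @Num.conj K[i]}.
Hypothesis norm_form : forall x : H, `|x| ^+ 2 = form x x.
Local Notation rip := (rip form).
Local Notation positive := (positive_operator form).
Local Notation tr := (trace form).
Implicit Types (x y z : H) (A B S P : H -> H).

Lemma positive_operator0 : positive 0.
Proof.
split=> [|x]; last by rewrite -[0 x]/(0 : H) linear0l.
split=> [a x y|]; first by rewrite scaler0 addr0.
by exists 0 => x; rewrite normr0 mul0r.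
Qed.

Lemma positive_operatorD A B : positive A -> positive B -> positive (A + B).
Proof.
move=> [bA pA] [bB pB]; split=> [|x].
  rewrite -[B]opprK; apply: bounded_operatorB => //; rewrite -sub0r.
  by apply: bounded_operatorB => //; case: positive_operator0.
rewrite -[(A + B) x]/(A x + B x) linearDl; apply: addr_ge0; [exact: pA|exact: pB].
Qed.

Lemma positive_operator_conj S P : positive S -> positive P ->
  positive (S \o P \o S).
Proof.
move=> /[dup] pS /positive_operatorP[bS sS _] [bP pP]; split=> [|x].
  by do 2 apply: bounded_operator_comp => //.
by rewrite /= (positive_form _ _ pS).
Qed.

Lemma positive_operator_sum I (r : seq I) (F : I -> H -> H) :
  (forall i, positive (F i)) -> positive (\sum_(i <- r) F i).
Proof.
move=> pF; elim/big_ind: _ => //; first exact: positive_operator0.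
exact: positive_operatorD.
Qed.

Lemma trace_ge0 A : positive A -> (0 <= tr A)%E.
Proof.
move=> /positive_operatorP[_ _ pA].
by apply: esum_ge0 => x _; rewrite lee_fin; exact: pA.
Qed.

Lemma traceD A B : positive A -> positive B -> tr (A + B) = (tr A + tr B)%E.
Proof.
move=> /positive_operatorP[_ _ pA] /positive_operatorP[_ _ pB].
rewrite /trace -esumD => [|x _|x _]; rewrite ?lee_fin; last 2 first.
- exact: pA.
- exact: pB.
apply: eq_esum => x _; rewrite -EFinD; congr EFin.
exact: ripDl.
Qed.

Lemma trace0 : tr 0 = 0%E.
Proof. by apply: esum1 => x _; rewrite -[0 x]/(0 : H) linear0l. Qed.

Lemma trace_sum I (r : seq I) (F : I -> H -> H) :
  (forall i, positive (F i)) ->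
  tr (\sum_(i <- r) F i) = (\sum_(i <- r) tr (F i))%E.
Proof.
move=> pF; elim: r => [|i r IH]; first by rewrite !big_nil trace0.
by rewrite !big_cons traceD ?IH //; exact: positive_operator_sum.
Qed.

Lemma traceB A B : positive B -> positive (A - B) ->
  (tr (A - B)%R + tr B)%E = tr A.
Proof. by move=> pB pAB; rewrite -traceD // subrK. Qed.

Lemma trace_norm_positive A : positive A -> trace_norm form A = tr A.
Proof. by move=> pA; rewrite /trace_norm (abs_operator_positive norm_form). Qed.

Lemma trace_norm_opp A : positive A -> trace_norm form (- A) = tr A.
Proof. by move=> pA; rewrite /trace_norm (abs_operator_opp norm_form). Qed.

Lemma compression_positive P A : positive P -> positive A ->
  positive (compression form P A).
Proof.
move=> pP pA; have [pS _] := sqrt_operatorP norm_form pA.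
exact: positive_operator_conj.
Qed.

(** [A - A^{1/2} P A^{1/2} = A^{1/2} (I - P) A^{1/2}]. *)
Lemma compressionC_positive P A : positive (fun x => x - P x) -> positive A ->
  positive (A - compression form P A).
Proof.
move=> pP pA; have [pS SS] := sqrt_operatorP norm_form pA.
have -> : A - compression form P A =
    sqrt_operator form A \o (fun x => x - P x) \o sqrt_operator form A.
  rewrite -{1}SS; apply/funext => x /=.
  by rewrite (linB pS.1.1).
exact: positive_operator_conj.
Qed.

Lemma sum_compression I (r : seq I) (P : I -> H -> H) A : positive A ->
  (forall x, \sum_(i <- r) P i x = x) ->
  \sum_(i <- r) compression form (P i) A = A.
Proof.
move=> pA P1; have [pS SS] := sqrt_operatorP norm_form pA.
apply/funext => x; rewrite fct_sumE -{2}SS /= -[in RHS](P1 (sqrt_operator form A x)).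
by rewrite (big_morph _ (linD pS.1.1) (lin0 pS.1.1)).
Qed.

End Traces.

(** * Greedy extraction *)

Section GreedyStep.
Variables (K : realType) (H : completeNormedModType K[i]).
Variable form : {dot H for @Num.conj K[i]}.
Hypothesis norm_form : forall x : H, `|x| ^+ 2 = form x x.
Local Notation positive := (positive_operator form).
Local Notation tr := (trace form).

Lemma sum_le_max (I : eqType) (s : seq I) (f : I -> \bar K) (c : K) :
  (forall i, i \in s -> (f i <= c%:E)%E) ->
  (\sum_(i <- s) f i <= ((size s)%:R * c)%:E)%E.
Proof.
elim: s => [|i s IH] fc; first by rewrite big_nil mul0r.
rewrite big_cons /= -add1n natrD mulrDl mul1r EFinD; apply: leeD.
  by apply: fc; rewrite inE eqxx.
by apply: IH => j js; apply: fc; rewrite inE js orbT.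
Qed.

Lemma greedy_ratio_bounds (I : choiceType) (F : {fset I}) (w : I) :
  w \in F -> 0 <= 1 - (#|` F|%:R)^-1 :> K /\ 1 - (#|` F|%:R)^-1 < 1 :> K.
Proof.
move=> wF.
have N0 : (0 < #|` F|)%N by rewrite cardfs_gt0; apply/fset0Pn; exists w.
by rewrite subr_ge0 ltrBlDr ltrDl invr_gt0 ltr0n invf_le1 ?ltr0n // ler1n.
Qed.

(** The traces of the [#|` F|] compressions add up to [tr A], so the largest of
    them is at least [tr A / #|` F|]. *)
Lemma greedy_step (I : choiceType) (F : {fset I}) (W : I -> set H)
    (P : I -> H -> H) (A : H -> H) (w : I) :
  (forall v, closed_subspace (W v)) ->
  (forall v, orthogonal_projection form (W v) (P v)) ->
  orthogonal_sum form F W setT ->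
  positive A -> (tr A < +oo)%E -> w \in F ->
  (forall v, v \in F ->
     (tr (compression form (P v) A) <= tr (compression form (P w) A))%E) ->
  (tr (A - compression form (P w) A)%R
     <= (1 - (#|` F|%:R)^-1)%:E * tr A)%E.
Proof.
move=> cW projP sumW pA trA wF wmax.
have pP v := orthogonal_projection_positive norm_form (cW v) (projP v).
have pC v : positive (compression form (P v) A).
  exact: compression_positive.
have pD : positive (A - compression form (P w) A).
  apply: compressionC_positive => //.
  exact (orthogonal_projectionC_positive norm_form (cW w) (projP w)).
have trC := trace_sum F pC.
rewrite (sum_compression norm_form pA) in trC; last first.
  by move=> x; exact: orthogonal_sum_projections.
have trD := traceB (pC w) pD.
have N0 : 0 < (#|` F|%:R : K) by rewrite ltr0n cardfs_gt0; apply/fset0Pn; exists w.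
move: trA trD (trace_ge0 pA) (trace_ge0 pD) (trace_ge0 (pC w)) trC wmax.
case: (tr A) (tr (A - _)%R) (tr (compression _ _ A)) => [a| |] [d| |] [c| |] //.
rewrite -EFinD => _ [da] _ _ _ aE /sum_le_max.
rewrite -aE -EFinM !lee_fin -da => le_a.
have : (d + c) / #|` F|%:R <= c by rewrite ler_pdivrMr // mulrC.
by rewrite mulrBl mul1r [_^-1 * _]mulrC; lra.
Qed.

Lemma greedy_trace_le (T : rooted_tree) (W : T -> set H) (P : T -> H -> H)
    (R : H -> H) (n : nat) (Rs D : nat -> H -> H) :
  subspace_tree form W ->
  (forall w, orthogonal_projection form (W w) (P w)) ->
  positive R -> (tr R < +oo)%E -> greedy_extraction form P n R Rs D ->
  forall k, [/\ positive (Rs k), positive (D k.+1)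
    & (tr (Rs k) <= ((1 - (#|` level T n|%:R)^-1) ^+ k)%:E * tr R)%E].
Proof.
move=> [cW sumW _] projP pR trR [Rs0 step].
have pP v := orthogonal_projection_positive norm_form (cW v) (projP v).
have pPC v := orthogonal_projectionC_positive norm_form (cW v) (projP v).
set q := 1 - _.
have [q0 _] : 0 <= q /\ q < 1.
  by have [w [wl _ _ _]] := step 0%N; exact: greedy_ratio_bounds wl.
suff H1 k : positive (Rs k) /\ (tr (Rs k) <= (q ^+ k)%:E * tr R)%E.
  move=> k; have [pRk ?] := H1 k; split=> //.
  by have [w [_ _ -> _]] := step k; exact: compression_positive.
elim: k => [|k [pRk trk]]; first by rewrite Rs0 expr0 mul1e.
have [w [wl wmax -> ->]] := step k; split.
  exact: compressionC_positive.
have fink : (tr (Rs k) < +oo)%E.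
  apply: le_lt_trans trk _.
  by rewrite lte_mul_pinfty ?lee_fin ?exprn_ge0.
apply: le_trans (greedy_step cW projP (sumW n) pRk fink wl wmax) _.
by rewrite exprS EFinM -muleA lee_wpmul2l ?lee_fin.
Qed.

End GreedyStep.

Unset Implicit Arguments.

Theorem theorem4p1 (K : realType) (H : completeNormedModType K[i])
    (form : {dot H for @Num.conj K[i]})
    (norm_form : forall x : H, `|x| ^+ 2 = form x x)
    (T : rooted_tree) (W : T -> set H) (P : T -> H -> H)
    (W_tree : subspace_tree form W)
    (P_proj : forall w : T, orthogonal_projection form (W w) (P w))
    (R : H -> H) (R_trace_class : trace_class form R)
    (R_positive : positive_operator form R)
    (n : nat) (n_ge1 : (1 <= n)%N)
    (Rs D : nat -> H -> H)
    (greedy : greedy_extraction form P n R Rs D) :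
  let q : K := 1 - (#|` level T n|%:R)^-1 in
  [/\ forall k : nat,
        (trace form (Rs k) <= (q ^+ k)%:E * trace form R)%E,
      cvg_trace_class form Rs 0,
      cvg_trace_class form (fun m => \sum_(1 <= k < m.+1) D k) R
    & forall m : nat, (1 <= m)%N ->
        trace_norm form (R - \sum_(1 <= k < m.+1) D k) = trace_norm form (Rs m)
        /\ (trace_norm form (Rs m) <= (q ^+ m)%:E * trace form R)%E].
Proof.
move=> q.
have trR : (trace form R < +oo)%E.
  by rewrite -(trace_norm_positive norm_form R_positive); exact: R_trace_class.2.
have inv := greedy_trace_le norm_form W_tree P_proj R_positive trR greedy.
have pRs k : positive_operator form (Rs k) by case: (inv k).
have trRs k : (trace form (Rs k) <= (q ^+ k)%:E * trace form R)%E by case: (inv k).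
have [Rs0 step] := greedy.
have sumD m : \sum_(1 <= k < m.+1) D k = R - Rs m.
  elim: m => [|m IH]; first by rewrite big_geq // Rs0 subrr.
  have [w [_ _ _ ->]] := step m.
  by rewrite big_nat_recr //= IH opprB addrC addrCA addrA.
have normRs k : trace_norm form (Rs k) = trace form (Rs k).
  exact: trace_norm_positive.
have pS m : positive_operator form (\sum_(1 <= k < m.+1) D k).
  by rewrite big_add1; apply: positive_operator_sum => k; case: (inv k).
have [q0 q1] : 0 <= q /\ q < 1.
  by have [w [wl _ _ _]] := step 0%N; exact: greedy_ratio_bounds wl.
have tr_cvg : trace form (Rs k) @[k --> \oo] --> 0%E.
  apply: (@squeeze_cvge _ _ _ _ (cst 0%E) _ (fun k => ((q ^+ k)%:E * trace form R)%E)).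
  - by apply: nearW => k; rewrite trace_ge0 //= trRs.
  - exact: cvg_cst.
  - rewrite -(mul0e (trace form R)); apply: cvgeZr.
      by rewrite ge0_fin_numE // trace_ge0.
    apply: cvg_EFin; first exact: nearW.
    by apply: cvg_expr; rewrite ger0_norm.
have tc A : positive_operator form A -> (trace form A <= trace form R)%E ->
    trace_class form A.
  move=> pA AR; split; first exact: pA.1.
  by rewrite trace_norm_positive //; exact: le_lt_trans trR.
have Rs_le k : (trace form (Rs k) <= trace form R)%E.
  apply: le_trans (trRs k) _; rewrite -[leRHS]mul1e lee_wpmul2r ?trace_ge0 //.
  by rewrite lee_fin exprn_ile1 // ltW.
split=> // [||m m1].
- split=> [k||]; first exact: tc.
    apply: tc; first exact: positive_operator0.
    by rewrite trace0 trace_ge0.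
  apply: cvg_trans tr_cvg; apply: near_eq_cvg; apply: nearW => k.
  by rewrite subr0 normRs.
- split=> [k|//|]; first apply: tc => //.
    have := pS k; rewrite sumD => pRk.
    by rewrite -(traceB (pRs k) pRk) leeDl // trace_ge0.
  apply: cvg_trans tr_cvg; apply: near_eq_cvg; apply: nearW => k.
  by rewrite sumD addrAC subrr add0r trace_norm_opp.
- by rewrite sumD subKr normRs; split.
Qed.
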